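(* In the setting of the context, suppose the regularity assumption and the local worst-case oracle assumption hold, and fix $x\in\mathcal X$ (write $\ell_k(z)=\ell_k(x,z)$), $k\in[K]$ and $i\in[N]$. For $u\ge0$ let $$S_k(u;\hat z_i)=\max\{\ell_k(\hat z_i+v):v\in\mathbb R^m,\ \hat z_i+v\in\mathcal Z,\ c(\hat z_i+v,\hat z_i)\le u\}.$$ Then for every $u\ge0$: if $p=1$, $$S_k(u;\hat z_i)-S_k(0;\hat z_i)\le C_i+g\,u^r;$$ and for every $p\ge1$, $$S_k(u;\hat z_i)-S_k(0;\hat z_i)\le G_i\,u^{1/p},$$ where $C_i:=\max_{k\in[K]}\{g+g\|\hat z_i-\hat z_0\|^r-\ell_k(\hat z_i)\}$, $G_i:=\max_{k\in[K]}\max\{\|\xi\|_*:\xi\in\partial\ell_k(\hat z_i)\}$, and $g,\hat z_0,r$ are the constant, reference point and exponent from part (iii) of the regularity assumption for the fixed $x$ (case $p=1$).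
   Context: Notation: $[n]=\{1,\dots,n\}$; $\mathcal P(\mathcal Z)$ is the set of Borel probability measures on $\mathcal Z$; $\|\cdot\|_*$ is the dual norm of the norm $\|\cdot\|$ below; $\partial\ell_k(\hat z_i)$ is the superdifferential of the concave function $\ell_k$ at $\hat z_i$; $0^0=1$. Setting. $\mathcal X\subseteq\mathbb R^n$, $\mathcal Z\subseteq\mathbb R^m$. A transportation cost $c:\mathcal Z\times\mathcal Z\to\mathbb R_+$ is lower semicontinuous, satisfies $c(z,z)=0$ for all $z$, and $c(\cdot,\hat z)$ is convex for every fixed $\hat z\in\mathcal Z$. The optimal transport discrepancy is $\mathrm{OT}_c(\mathbb P,\mathbb Q)=\min_{\gamma}\mathbb E_{(z,\hat z)\sim\gamma}[c(z,\hat z)]$ over couplings $\gamma$ of $\mathbb P$ and $\mathbb Q$. Given $\hat z_1,\dots,\hat z_N\in\mathcal Z$, let $\hat{\mathbb P}=\frac1N\sum_{i=1}^N\delta_{\hat z_i}$; given $\rho>0$, let $\mathcal P=\{\mathbb P\in\mathcal P(\mathcal Z):\mathrm{OT}_c(\mathbb P,\hat{\mathbb P})\le\rho\}$. Regularity assumption. (i) $\mathcal X$ is nonempty and convex; there exist $\mathbb Q_0\in\mathcal P$ and $x_0\in\mathcal X$ such that $x\mapsto\mathbb E_{z\sim\mathbb Q_0}[\ell(x,z)]$ is inf-compact on $\mathcal X$ (all sublevel sets are compact) and $\mathbb E_{z\sim\mathbb Q_0}[\ell(x_0,z)]>-\infty$; $\mathcal Z$ is nonempty, closed and convex. (ii)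 $\ell(x,z)=\max_{k\in[K]}\ell_k(x,z)$ with $K\ge2$, where each $\ell_k:\mathbb R^n\times\mathbb R^m\to\mathbb R$ is real-valued, convex in its first and concave in its second argument. (iii) There exist a norm $\|\cdot\|$ on $\mathbb R^m$ and $p\ge1$ with $c(z,\hat z)\ge\|z-\hat z\|^p$ for all $z,\hat z\in\mathcal Z$; moreover, if $p=1$, then for every $x\in\mathcal X$ there exist $g>0$, $\hat z_0\in\mathcal Z$ and $r\in[0,1)$ such that $\ell(x,z)\le g[1+\|z-\hat z_0\|^r]$ for all $z\in\mathcal Z$. Local worst-case oracle assumption. For any $k\in[K]$, $\hat z\in\mathcal Z$, radius $u\ge0$ and accuracy $\epsilon>0$ there is an algorithm that returns $\hat v\in\mathbb R^m$ with $\hat z+\hat v\in\mathcal Z$, $c(\hat z+\hat v,\hat z)\le u$, together with $\hat L=\ell_k(\hat z+\hat v)\ge\max\{\ell_k(\hat z+v):v\in\mathbb R^m,\hat z+v\in\mathcal Z,c(\hat z+v,\hat z)\le u\}-\epsilon$. *)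

(* Defs.v *)
(* MathComp / MathComp-Analysis, over an arbitrary R : realType. *)
From HB Require Import structures.
From mathcomp Require Import all_boot all_order all_algebra.
From mathcomp Require Import all_classical all_reals all_analysis.

Set Implicit Arguments.
Unset Strict Implicit.
Unset Printing Implicit Defensive.

Import Order.TTheory GRing.Theory Num.Theory.
Import numFieldNormedType.Exports.

Local Open Scope classical_set_scope.
Local Open Scope ring_scope.

Section Maxima.
Context {R : realType}.

(* Maxima of sets of reals are written [sup A]; this is the maximum of [A]
   exactly when [has_max A] holds ([sup] is a junk value when [A] is empty or
   unbounded above). *)
Definition has_max (A : set R) : Prop := exists2 a, A a & ubound A a.

Definition fam_max (K : nat) (F : 'I_K -> R) : R := sup (range F).

End Maxima.

Section EuclideanSpace.
Context {R : realType} {m : nat}.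
Implicit Types (v w xi z : 'rV[R]_m).

Definition dot xi v : R := \sum_(j < m) xi 0 j * v 0 j.

(* Nonnegativity and N 0 = 0 follow from these three axioms. *)
Definition is_norm (nrm : 'rV[R]_m -> R) : Prop :=
  [/\ forall v, nrm v = 0 -> v = 0,
      forall (a : R) v, nrm (a *: v) = `|a| * nrm v
    & forall v w, nrm (v + w) <= nrm v + nrm w].

Definition dual_norm (nrm : 'rV[R]_m -> R) xi : R :=
  sup [set dot xi v | v in [set v | nrm v <= 1]].

Definition concave_function (f : 'rV[R]_m -> R) : Prop :=
  convex_function setT (fun z => - f z).

Definition superdifferential (f : 'rV[R]_m -> R) z0 : set 'rV[R]_m :=
  [set xi | forall z, f z <= f z0 + dot xi (z - z0)].

End EuclideanSpace.

(* R^m with its Borel sigma-algebra *)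
Notation borelV R m := (g_sigma_algebraType (@open 'rV[R]_m)).

Section OptimalTransport.
Context {R : realType} {m : nat}.
Local Notation T := (borelV R m).
Local Open Scope ereal_scope.

(* Lower semicontinuity and convexity are relative to Z, since a cost is only
   defined on Z x Z; its values outside are irrelevant. *)
Definition transport_cost (Z : set 'rV[R]_m)
    (c : 'rV[R]_m -> 'rV[R]_m -> R) : Prop :=
  [/\ forall z zh, Z z -> Z zh -> (0 <= c z zh)%R,
      @lower_semicontinuous (subspace (Z `*` Z)) R
        (fun w => (c w.1 w.2)%:E),
      forall z, Z z -> c z z = 0%R
    & forall zh, Z zh -> convex_function Z (c ^~ zh)].

Definition coupling (P Q : {measure set T -> \bar R})
    (gamma : probability (T * T)%type R) : Prop :=
  forall A : set T, measurable A ->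
    gamma (A `*` setT) = P A /\ gamma (setT `*` A) = Q A.

(* For P and Q carried by Z, every coupling is carried by Z x Z.  When c is a
   transport cost on a closed Z, the infimum is a minimum. *)
Definition OT (Z : set 'rV[R]_m) (c : 'rV[R]_m -> 'rV[R]_m -> R)
    (P Q : {measure set T -> \bar R}) : \bar R :=
  ereal_inf [set \int[gamma]_(w in Z `*` Z) (c w.1 w.2)%:E |
              gamma in coupling P Q].

Section Empirical.
Context {N : nat} (zh : 'I_N -> 'rV[R]_m).

Definition empirical (A : set T) : \bar R :=
  (N%:R^-1)%:E * \sum_(i < N) \d_(zh i : T) A.

Let aux (j : nat) : {measure set T -> \bar R} :=
  if insub j is Some i then @dirac _ T (zh i) R else mzero.

Let empiricalE :
  empirical = mscale ((N%:R : R)^-1%:nng)%R (msum aux N).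
Proof.
apply/funext => A; rewrite /empirical /mscale /msum /=; congr (_ * _).
by apply: eq_bigr => i _; rewrite /aux valK.
Qed.

Let empirical0 : empirical set0 = 0.
Proof. by rewrite empiricalE measure0. Qed.

Let empirical_ge0 A : 0 <= empirical A.
Proof. by rewrite empiricalE measure_ge0. Qed.

Let empirical_sigma_additive : semi_sigma_additive empirical.
Proof. by rewrite empiricalE; exact: measure_semi_sigma_additive. Qed.

HB.instance Definition _ := isMeasure.Build _ T R empirical
  empirical0 empirical_ge0 empirical_sigma_additive.

End Empirical.

Definition ambiguity_set (N : nat) (Z : set 'rV[R]_m)
    (c : 'rV[R]_m -> 'rV[R]_m -> R) (zh : 'I_N -> 'rV[R]_m) (rho : R) :
    set (probability T R) :=
  [set P : probability T R | P Z = 1 /\ OT Z c P (empirical zh) <= rho%:E].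

End OptimalTransport.

Section Setting.
Context {R : realType} {n m K N : nat}.
Variables (X : set 'rV[R]_n) (Z : set 'rV[R]_m).
Variables (c : 'rV[R]_m -> 'rV[R]_m -> R).
Variables (ell : 'I_K -> 'rV[R]_n -> 'rV[R]_m -> R).
Variables (nrm : 'rV[R]_m -> R) (p : R).

Definition loss (x : 'rV[R]_n) (z : 'rV[R]_m) : R :=
  fam_max (fun k => ell k x z).

(* The integral is -oo by convention when both the positive and the negative
   part of the loss have infinite integral. *)
Definition expected_loss (Q : probability (borelV R m) R)
    (x : 'rV[R]_n) : \bar R :=
  (\int[Q]_(z in Z) (loss x z)%:E)%E.

Definition inf_compact_on (f : 'rV[R]_n -> \bar R) : Prop :=
  forall a : R, compact [set x | X x /\ (f x <= a%:E)%E].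

(* [powR] satisfies [0 `^ 0 = 1]. *)
Definition growth_bound (x : 'rV[R]_n)
    (g : R) (z0 : 'rV[R]_m) (r : R) : Prop :=
  [/\ 0 < g, Z z0, 0 <= r < 1
    & forall z, Z z -> loss x z <= g * (1 + nrm (z - z0) `^ r)].

Definition regularity (zh : 'I_N -> 'rV[R]_m) (rho : R) : Prop :=
  [/\ [/\ X !=set0, convex_set X,
          exists Q0 x0, [/\ ambiguity_set Z c zh rho Q0, X x0,
            inf_compact_on (expected_loss Q0)
            & (-oo < expected_loss Q0 x0)%E],
          Z !=set0
        & closed Z /\ convex_set Z],
      [/\ (2 <= K)%N,
          forall k z, convex_function setT ((ell k)^~ z)
        & forall k x, concave_function (ell k x)]
    & [/\ is_norm nrm, 1 <= p,
          forall z zh, Z z -> Z zh -> nrm (z - zh) `^ p <= c z zh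
        & p = 1 -> forall x, X x -> exists g z0 r, growth_bound x g z0 r]].

(* The losses ell_k (x, zh + v) over the perturbations v of cost at most u *)
Definition local_losses (x : 'rV[R]_n) (k : 'I_K) (zh : 'rV[R]_m) (u : R) :
    set R :=
  [set ell k x (zh + v) | v in [set v | Z (zh + v) /\ c (zh + v) zh <= u]].

Definition local_worst_case x k zh u : R := sup (local_losses x k zh u).

(* The algorithm is modelled by the function mapping its inputs
   (k, zh, u, eps) to its outputs (v, L). *)
Definition local_oracle (x : 'rV[R]_n) : Prop :=
  exists alg : 'I_K -> 'rV[R]_m -> R -> R -> 'rV[R]_m * R,
  forall k zh u eps, Z zh -> 0 <= u -> 0 < eps ->
    let: (v, L) := alg k zh u eps in
    [/\ Z (zh + v), c (zh + v) zh <= u, L = ell k x (zh + v)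
      & local_worst_case x k zh u - eps <= L].

Definition growth_const (x : 'rV[R]_n) (zi : 'rV[R]_m)
    (g : R) (z0 : 'rV[R]_m) (r : R) : R :=
  fam_max (fun k => g + g * nrm (zi - z0) `^ r - ell k x zi).

Definition supergradient_norms (x : 'rV[R]_n) (k : 'I_K) (zi : 'rV[R]_m) :
    set R :=
  [set dual_norm nrm xi | xi in superdifferential (ell k x) zi].

Definition lipschitz_const (x : 'rV[R]_n) (zi : 'rV[R]_m) : R :=
  fam_max (fun k => sup (supergradient_norms x k zi)).

End Setting.

(* Main.v *)
(* Since c dominates the p-th power of the norm, a perturbation of cost at most
   u has norm at most u^(1/p); in particular the perturbations of cost at most
   u form a compact set. A real-valued concave function on R^m has a
   supergradient at every point, hence is upper semicontinuous and attains its
   maximum on that set. A supergradient xi at z gives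
   f (z + v) - f z <= <xi, v> <= |xi|_* |v|, which is the Lipschitz bound; the
   bound for p = 1 follows from the growth condition and the subadditivity of
   t |-> t^r for r <= 1. *)
Require Import Defs.
From HB Require Import structures.
From mathcomp Require Import all_boot all_order all_algebra.
From mathcomp Require Import all_classical all_reals all_analysis.
From mathcomp Require Import ring lra.
Set Implicit Arguments.
Unset Strict Implicit.
Unset Printing Implicit Defensive.
Import Order.TTheory GRing.Theory Num.Theory.
Import numFieldNormedType.Exports.
Local Open Scope classical_set_scope.
Local Open Scope ring_scope.

Lemma has_max_has_ubound (R : realType) (A : set R) : has_max A -> has_ubound A.
Proof. by case=> a _ ubA; exists a. Qed.

Lemma usc_compact_has_max (T : topologicalType) (R : realType) (f : T -> R)
    (A : set T) :
  A !=set0 -> compact A ->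
  (forall t a, A t -> f t < a -> \forall s \near t, f s < a) ->
  has_max (f @` A).
Proof.
move=> [t0 At0] cA uscf.
pose B y := [set z | A z /\ f y <= f z].
have FF : ProperFilter (filter_from A B).
  apply: filter_from_proper => [|y Ay]; last by exists y.
  apply: filter_from_filter; first by exists t0.
  move=> y z Ay Az; case: (leP (f y) (f z)) => fyz.
    by exists z => // w [Aw fw]; split; split=> //; exact: le_trans fw.
  by exists y => // w [Aw fw]; split; split=> //; exact: le_trans (ltW fyz) fw.
have [|t [At clt]] := cA _ FF; first by exists t0 => // w [].
exists (f t); first by exists t.
move=> _ [y Ay <-]; rewrite leNgt; apply/negP => fty.
have [||z [[_ yz]]] := clt (B y) [set s | f s < f y].
- by exists y.
- exact: uscf.
by rewrite /= ltNge yz.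
Qed.

Lemma continuous_compact_has_max (T : topologicalType) (R : realType)
    (f : T -> R) (A : set T) :
  A !=set0 -> compact A -> continuous f -> has_max (f @` A).
Proof.
move=> A0 cA cf.
have [t /set_mem At maxt] := compact_EVT_max A0 cA (continuous_subspaceT cf).
by exists (f t); [exists t|move=> _ [s As <-]; exact/maxt/mem_set].
Qed.

Lemma fam_max_ge (R : realType) (K : nat) (F : 'I_K -> R) k : F k <= fam_max F.
Proof.
apply: ub_le_sup; last by exists k.
exists (\sum_i `|F i|) => _ [i _ <-].
by rewrite (bigD1 i)//= ler_wpDr ?sumr_ge0// ler_norm.
Qed.

Lemma powRD_subadditive (R : realType) (r a b : R) :
  0 <= r <= 1 -> 0 <= a -> 0 <= b -> (a + b) `^ r <= a `^ r + b `^ r.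
Proof.
move=> /andP[r0 r1] a0 b0.
have [s0|s_neq0] := eqVneq (a + b) 0.
  have -> : a = 0 by lra.
  by rewrite add0r lerDr powR_ge0.
have s0 : 0 < a + b by rewrite lt_neqAle eq_sym s_neq0 addr_ge0.
have key x : 0 <= x <= a + b -> x / (a + b) * (a + b) `^ r <= x `^ r.
  move=> /andP[]; rewrite le_eqVlt => /predU1P[<- _|x0 xs].
    by rewrite !mul0r powR_ge0.
  have q : 0 < x / (a + b) <= 1 by rewrite divr_gt0//= ler_pdivrMr// mul1r.
  have -> : x `^ r = (x / (a + b)) `^ r * (a + b) `^ r.
    by rewrite -powRM ?divfK// ltW// divr_gt0.
  by rewrite ler_wpM2r ?powR_ge0// ger1_powR.
have ka := key a; have kb := key b.
have -> : (a + b) `^ r =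
    a / (a + b) * (a + b) `^ r + b / (a + b) * (a + b) `^ r.
  by rewrite -mulrDl -mulrDl divff// mul1r.
by rewrite lerD// ?ka ?kb//; lra.
Qed.

Section EuclideanSpaceTheory.
Context {R : realType} {m : nat}.
Implicit Types (v w xi z : 'rV[R]_m) (nrm f : 'rV[R]_m -> R).

Lemma dotDr xi v w : dot xi (v + w) = dot xi v + dot xi w.
Proof. by rewrite -big_split; apply: eq_bigr => j _; rewrite mxE mulrDr. Qed.

Lemma dotZr xi a v : dot xi (a *: v) = a * dot xi v.
Proof.
by rewrite /dot mulr_sumr; apply: eq_bigr => j _; rewrite mxE mulrCA.
Qed.

Lemma dotDl xi zeta v : dot (xi + zeta) v = dot xi v + dot zeta v.
Proof. by rewrite -big_split; apply: eq_bigr => j _; rewrite mxE mulrDl. Qed.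

Lemma dot0r xi : dot xi 0 = 0.
Proof. by rewrite -(scale0r (0 : 'rV_m)) dotZr mul0r. Qed.

Lemma dot_delta xi j : dot xi 'e_j = xi 0 j.
Proof.
rewrite /dot (bigD1 j)//= mxE !eqxx mulr1 big1 ?addr0// => i ij.
by rewrite mxE (negPf ij) andbF mulr0.
Qed.

Lemma dot_scale_delta a j v : dot (a *: 'e_j) v = a * v 0 j.
Proof.
rewrite /dot (bigD1 j)//= !mxE !eqxx mulr1 big1 ?addr0// => i ij.
by rewrite !mxE (negPf ij) andbF mulr0 mul0r.
Qed.

Lemma concave_functionP f : concave_function f <->
  forall (t : R) v w, 0 <= t <= 1 ->
    t * f v + (1 - t) * f w <= f (t *: v + (1 - t) *: w).
Proof.
split=> cf t v w.
  move=> /andP[t0 t1]; have := cf (Itv01 t0 t1) v w.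
  rewrite !inE => /(_ I I); rewrite /conv/= => h.
  by rewrite -lerN2 opprD -!mulrN; exact: h.
move=> _ _; have := cf t%:num v w.
have -> : 0 <= t%:num <= 1 by apply/andP.
by move=> /(_ isT); rewrite -lerN2 opprD -!mulrN.
Qed.

Section Supergradient.
Variables (H : 'rV[R]_m -> R) (Hconcave : concave_function H).
Let vanish_from (j : nat) v := forall i : 'I_m, (j <= i)%N -> v 0 i = 0.

(* The one-dimensional extension step of the Hahn-Banach theorem: the slopes
   of H on the two sides of the hyperplane v_j = 0 are separated. *)
Lemma extend_slope (j : 'I_m) : (forall v, vanish_from j v -> H v <= 0) ->
  exists b, forall v, vanish_from j.+1 v -> H v <= b * v 0 j.
Proof.
move=> H0.
have slopes v w : vanish_from j.+1 v -> vanish_from j.+1 w ->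
    0 < v 0 j -> w 0 j < 0 -> H v / v 0 j <= H w / w 0 j.
  set s := v 0 j; set s' := w 0 j => Vv Vw s0 s'0.
  have d0 : 0 < s - s' by lra.
  pose t := - s' / (s - s').
  have tE : 1 - t = s / (s - s') by rewrite /t; field; rewrite gt_eqF.
  have t0 : 0 <= t by rewrite divr_ge0//; lra.
  have t1 : 0 <= 1 - t by rewrite tE divr_ge0//; lra.
  have t01 : 0 <= t <= 1 by lra.
  have := (concave_functionP H).1 Hconcave t v w t01 => /le_trans /(_ (H0 _ _)).
  have V0 : vanish_from j (t *: v + (1 - t) *: w).
    move=> i; rewrite leq_eqVlt !mxE => /predU1P[ji|ji].
      have -> : i = j by exact/val_inj.
      by rewrite -/s -/s' tE /t; field; rewrite gt_eqF.
    by rewrite Vv// Vw// !mulr0 addr0.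
  move=> /(_ V0); rewrite tE /t => h.
  have {}h : - s' * H v + s * H w <= 0.
    have -> : - s' * H v + s * H w
        = (s - s') * (- s' / (s - s') * H v + s / (s - s') * H w).
      by field; rewrite gt_eqF.
    by rewrite pmulr_rle0.
  rewrite ler_pdivrMr// mulrAC ler_ndivlMr//; lra.
have Ve (a : R) : vanish_from j.+1 (a *: 'e_j).
  by move=> i ji; rewrite !mxE [i == j]gtn_eqF ?andbF ?mulr0//.
have ej (a : R) : (a *: 'e_j : 'rV_m) 0 j = a by rewrite !mxE !eqxx mulr1.
pose A := [set H v / v 0 j | v in [set v | vanish_from j.+1 v /\ 0 < v 0 j]].
have ubA w : vanish_from j.+1 w -> w 0 j < 0 -> ubound A (H w / w 0 j).
  by move=> Vw w0 _ [v [Vv v0] <-]; exact: slopes.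
have hubA : has_ubound A.
  exists (H (-1 *: 'e_j) / (-1 *: 'e_j : 'rV_m) 0 j).
  by apply: ubA; rewrite ?ej.
exists (sup A) => v Vv; case: (ltgtP (v 0 j) 0) => vj.
- rewrite -ler_ndivlMr//; apply: ge_sup; last exact: ubA.
  exists (H (1 *: 'e_j) / (1 *: 'e_j : 'rV_m) 0 j), (1 *: 'e_j) => //=.
  by rewrite ej.
- by rewrite -ler_pdivrMr//; apply: ub_le_sup => //; exists v.
- rewrite vj mulr0; apply: H0 => i; rewrite leq_eqVlt => /predU1P[ji|/Vv//].
  by have -> : i = j by exact/val_inj.
Qed.

End Supergradient.

Lemma superdifferential_nonempty f z0 :
  concave_function f -> superdifferential f z0 !=set0.
Proof.
move=> /concave_functionP cf.
suff /(_ m (leqnn m))[xi hxi] : forall j, (j <= m)%N ->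
    exists xi, forall v, (forall i : 'I_m, (j <= i)%N -> v 0 i = 0) ->
      f (z0 + v) - f z0 <= dot xi v.
  exists xi => z; rewrite -lerBlDl -{1}(subrK z0 z) addrC (addrC _ z0).
  by rewrite addrC; apply: hxi => i; rewrite leqNgt ltn_ord.
elim=> [_|j IH jm].
  exists 0 => v v0; have -> : v = 0 by apply/rowP => i; rewrite v0// mxE.
  by rewrite addr0 subrr dot0r.
have [xi hxi] := IH (ltnW jm).
pose H v := f (z0 + v) - f z0 - dot xi v.
have cH : concave_function H.
  apply/concave_functionP => t v w t01; rewrite /H dotDr !dotZr.
  have := cf t (z0 + v) (z0 + w) t01.
  have -> : t *: (z0 + v) + (1 - t) *: (z0 + w)
      = z0 + (t *: v + (1 - t) *: w).
    by apply/rowP => i; rewrite !mxE; ring.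
  lra.
have [|b hb] := @extend_slope H cH (Ordinal jm).
  by move=> v Vv; rewrite /H subr_le0; exact: hxi.
exists (xi + b *: 'e_(Ordinal jm)) => v Vv.
by rewrite dotDl dot_scale_delta -lerBlDl; exact: hb.
Qed.

Lemma dot_continuous xi : continuous (dot xi).
Proof.
apply: continuous_big => [|j _]; first exact: add_continuous.
move=> v; apply: continuousM; first exact: cst_continuous.
exact: coord_continuous.
Qed.

Lemma dot_continuous2 : continuous (fun w : 'rV[R]_m * 'rV[R]_m => dot w.1 w.2).
Proof.
apply: continuous_big => [|j _]; first exact: add_continuous.
move=> w; apply: continuousM.
  apply: (@continuous_comp _ _ _ fst (fun v : 'rV[R]_m => v 0 j)).
    exact: cvg_fst.
  exact: coord_continuous.
apply: (@continuous_comp _ _ _ snd (fun v : 'rV[R]_m => v 0 j)).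
  exact: cvg_snd.
exact: coord_continuous.
Qed.

Lemma concave_usc f t a : concave_function f -> f t < a ->
  \forall s \near t, f s < a.
Proof.
move=> /(superdifferential_nonempty t)[xi hxi] fta.
have : {for t, continuous (dot xi \o (fun s : 'rV[R]_m => s - t))}.
  apply: continuous_comp.
    by apply: continuousB; [exact: cvg_id|exact: cst_continuous].
  exact: dot_continuous.
move=> /cvgr_lt /(_ (a - f t)); rewrite /= subrr dot0r subr_gt0 => /(_ fta).
apply: filterS => s h.
by rewrite (le_lt_trans (hxi s))// -ltrBrDl.
Qed.

Lemma normr_rV_le v M : 0 <= M -> (forall j, `|v 0 j| <= M) -> `|v| <= M.
Proof.
move=> M0 vM; rewrite -[leLHS]/(mx_norm v) mx_normrE.
apply: bigmax_le => // -[i j] _.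
by rewrite /= (ord1 i).
Qed.

Lemma closed_normr_le_compact (A : set 'rV[R]_m) M :
  closed A -> (forall v, A v -> `|v| <= M) -> compact A.
Proof.
move=> clA AM; apply: bounded_closed_compact => //.
exists M; split; first exact: num_real.
by move=> N MN v Av; apply: le_trans (AM v Av) (ltW MN).
Qed.

Lemma superdifferential_compact f z0 : compact (superdifferential f z0).
Proof.
pose M := \sum_j (`|f (z0 + 'e_j) - f z0| + `|f (z0 - 'e_j) - f z0|).
have M0 : 0 <= M by rewrite sumr_ge0// => j _; rewrite addr_ge0.
apply: (@closed_normr_le_compact _ M) => [|xi hxi].
  have -> : superdifferential f z0 =
      \bigcap_(z in setT) [set xi | f z <= f z0 + dot xi (z - z0)].
    by apply/seteqP; split=> xi h z; [move=> _|]; exact: h.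
  apply: closed_bigI => z _.
  have dotC xi : dot xi (z - z0) = dot (z - z0) xi.
    by apply: eq_bigr => i _; rewrite mulrC.
  have -> : [set xi | f z <= f z0 + dot xi (z - z0)] =
      dot (z - z0) @^-1` [set y | f z - f z0 <= y].
    by apply/seteqP; split=> xi /=; rewrite lerBlDl dotC.
  by apply: preimage_closed => [xi _|];
    [exact: dot_continuous|exact: closed_ge].
apply: normr_rV_le => // j; rewrite /M (bigD1 j)//= ler_wpDr//.
  by rewrite sumr_ge0// => i _; rewrite addr_ge0.
have := hxi (z0 + 'e_j); have := hxi (z0 - 'e_j).
rewrite ![z0 + _]addrC !addrK -scaleN1r dotZr dot_delta => h1 h2.
rewrite ler_norml; apply/andP; split.
  by have := ler_norm (-(f ('e_j + z0) - f z0)); rewrite normrN;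
     have := normr_ge0 (f (-1 *: 'e_j + z0) - f z0); lra.
by have := ler_norm (-(f (-1 *: 'e_j + z0) - f z0)); rewrite normrN;
   have := normr_ge0 (f ('e_j + z0) - f z0); lra.
Qed.

Section Norm.
Variables (nrm : 'rV[R]_m -> R) (nrmP : is_norm nrm).

Lemma is_norm0 : nrm 0 = 0.
Proof.
by case: nrmP => _ nrmZ _; rewrite -(scale0r (0 : 'rV_m)) nrmZ normr0 mul0r.
Qed.

Lemma is_normN v : nrm (- v) = nrm v.
Proof. by case: nrmP => _ nrmZ _; rewrite -scaleN1r nrmZ normrN1 mul1r. Qed.

Lemma is_norm_ge0 v : 0 <= nrm v.
Proof.
case: nrmP => _ _ /(_ v (- v)); rewrite subrr is_norm0 is_normN.
by rewrite -mulr2n pmulrn_lge0.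
Qed.

Lemma is_norm_le_normr : exists2 M, 0 <= M & forall v, nrm v <= M * `|v|.
Proof.
case: nrmP => _ nrmZ nrmD.
exists (\sum_j nrm 'e_j) => [|v].
  by rewrite sumr_ge0// => j _; exact: is_norm_ge0.
rewrite {1}(row_sum_delta v) mulr_suml.
apply: (@le_trans _ _ (\sum_j nrm (v 0 j *: 'e_j))).
  elim/big_ind2 : _ => [|? ? ? ? h1 h2|//]; first by rewrite is_norm0.
  by apply: le_trans (nrmD _ _) _; exact: lerD.
apply: ler_sum => j _; rewrite nrmZ mulrC ler_wpM2l ?is_norm_ge0//.
rewrite -[leRHS]/(mx_norm v) mx_normrE.
exact: (le_bigmax _ (fun ij => `|v ij.1 ij.2|) (0, j)).
Qed.

Lemma is_norm_continuous : continuous nrm.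
Proof.
have [M M0 nrmM] := is_norm_le_normr; case: (nrmP) => _ _ nrmD v.
have lip w : `|nrm v - nrm w| <= M * `|v - w|.
  apply: le_trans (nrmM _); rewrite ler_norml; apply/andP; split.
    by have := nrmD (w - v) v; rewrite subrK -(is_normN (w - v)) opprB; lra.
  by have := nrmD (v - w) w; rewrite subrK; lra.
have M1 : 0 < M + 1 by lra.
apply/(@cvgrPdist_lt _ _ _ (nbhs v) (nbhs_filter v)) => e e0.
have /(nbhsx_ballx v) : 0 < e / (M + 1) by rewrite divr_gt0.
rewrite -ball_normE; apply: (@filterS _ _ (nbhs_filter v)) => w /= vw.
apply: le_lt_trans (lip w) (le_lt_trans (y := (M + 1) * `|v - w|) _ _).
  by rewrite ler_wpM2r// lerDl.
by rewrite mulrC -ltr_pdivlMr.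
Qed.

Lemma normr_le_is_norm : exists2 C, 0 <= C & forall v, `|v| <= C * nrm v.
Proof.
case: (nrmP) => nrm_eq0 nrmZ _.
pose S := [set v : 'rV[R]_m | `|v| = 1].
have scale v : v != 0 -> S (`|v|^-1 *: v).
  by move=> v0; rewrite /S/= normrZ normfV normr_id mulVf// normr_eq0.
have [[v0 Sv0]|S0] := pselect (S !=set0); last first.
  exists 0 => // v; rewrite mul0r; have [->|v0] := eqVneq v 0.
    by rewrite normr0.
  by case: S0; exists (`|v|^-1 *: v); exact: scale.
have cS : compact S.
  apply: (@closed_normr_le_compact _ 1) => [|v ->//].
  have -> : S = (fun v => `|v|) @^-1` [set 1] by [].
  by apply: preimage_closed => [v _|];
    [exact: norm_continuous|exact: closed_eq].
have [|w /set_mem Sw minw] := EVT_min_rV (ex_intro _ v0 Sv0) cS (f := nrm).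
  exact: continuous_subspaceT is_norm_continuous.
have w0 : 0 < nrm w.
  rewrite lt_neqAle is_norm_ge0 andbT eq_sym; apply/eqP => /nrm_eq0 w0.
  by move: Sw; rewrite /S/= w0 normr0 => /eqP; rewrite eq_sym oner_eq0.
exists (nrm w)^-1 => [|v]; first by rewrite invr_ge0 ltW.
have [->|v0'] := eqVneq v 0; first by rewrite normr0 is_norm0 mulr0.
have := minw _ (mem_set (scale _ v0')).
rewrite nrmZ normfV normr_id ler_pdivlMl ?normr_gt0// => h.
by rewrite ler_pdivlMl// mulrC.
Qed.

Lemma is_norm_bounded_compact (A : set 'rV[R]_m) M :
  closed A -> (forall v, A v -> nrm v <= M) -> compact A.
Proof.
move=> clA AM; have [C C0 normC] := normr_le_is_norm.
apply: (@closed_normr_le_compact _ (C * M)) => // v Av.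
by apply: le_trans (normC v) _; rewrite ler_wpM2l// AM.
Qed.

Let B := [set v | nrm v <= 1].

Let compact_unit_ball : compact B.
Proof.
apply: (@is_norm_bounded_compact _ 1) => //.
have -> : B = nrm @^-1` [set y | y <= 1] by [].
by apply: preimage_closed => [v _|];
  [exact: is_norm_continuous|exact: closed_le].
Qed.

Let B0 : B 0. Proof. by rewrite /B/= is_norm0. Qed.

Let dual_norm_ubound xi : has_ubound [set dot xi v | v in B].
Proof.
apply/has_max_has_ubound/continuous_compact_has_max => //; first by exists 0.
exact: dot_continuous.
Qed.

Lemma dot_le_dual_norm xi v : nrm v <= 1 -> dot xi v <= dual_norm nrm xi.
Proof. by move=> v1; apply: ub_le_sup => //; exists v. Qed.

Lemma dual_norm_ge0 xi : 0 <= dual_norm nrm xi.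
Proof. by rewrite -(dot0r xi) dot_le_dual_norm// is_norm0. Qed.

Lemma dot_le_dual_normM xi v : dot xi v <= dual_norm nrm xi * nrm v.
Proof.
case: (nrmP) => nrm_eq0 nrmZ _; have [/nrm_eq0->|v0] := eqVneq (nrm v) 0.
  by rewrite dot0r is_norm0 mulr0.
have vgt0 : 0 < nrm v by rewrite lt_neqAle eq_sym v0 is_norm_ge0.
rewrite -ler_pdivrMr// mulrC -dotZr dot_le_dual_norm// nrmZ.
by rewrite normfV ger0_norm ?is_norm_ge0// mulVf.
Qed.

(* Maximizing the pairing jointly over the superdifferential and the unit ball
   avoids the continuity of the dual norm. *)
Lemma dual_norm_superdifferential_has_max f z0 : concave_function f ->
  has_max [set dual_norm nrm xi | xi in superdifferential f z0].
Proof.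
move=> /(superdifferential_nonempty z0)[xi0 hxi0].
have [||? [[xi v] [/= hxi hv] <-] ub] :=
    @continuous_compact_has_max _ R (fun w : 'rV[R]_m * 'rV[R]_m => dot w.1 w.2)
      (superdifferential f z0 `*` B) _
      (compact_setX (@superdifferential_compact f z0) compact_unit_ball).
- by exists (xi0, 0).
- exact: dot_continuous2.
exists (dual_norm nrm xi); first by exists xi.
move=> _ [zeta hzeta <-]; apply: ge_sup => [|_ [w hw <-]].
  by exists (dot zeta 0), 0.
apply: le_trans (dot_le_dual_norm xi hv).
by apply: ub; exists (zeta, w).
Qed.

End Norm.
End EuclideanSpaceTheory.

Lemma le_powR_inv (R : realType) (p t u : R) :
  0 < p -> 0 <= t -> t `^ p <= u -> t <= u `^ p^-1.
Proof.
move=> p0 t0 tu.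
have -> : t = (t `^ p) `^ p^-1 by rewrite -powRrM mulfV ?gt_eqF// powRr1.
have u0 : 0 <= u := le_trans (powR_ge0 _ _) tu.
by rewrite ge0_ler_powR// ?nnegrE ?invr_ge0 ?powR_ge0// ltW.
Qed.

Lemma growth_const_bound (R : realType) (m n K : nat) (Z : set 'rV[R]_m)
    (ell : 'I_K -> 'rV[R]_n -> 'rV[R]_m -> R) nrm x g z0 r k z v :
  is_norm nrm -> growth_bound Z ell nrm x g z0 r -> Z (z + v) ->
  ell k x (z + v) - ell k x z
    <= growth_const ell nrm x z g z0 r + g * nrm v `^ r.
Proof.
move=> nrmP [g0 _ /andP[r0 r1] hg] Zv.
have losszv := hg _ Zv.
have lossk := fam_max_ge (fun k => ell k x (z + v)) k.
have growthk := fam_max_ge (fun k => g + g * nrm (z - z0) `^ r - ell k x z) k.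
rewrite -/(growth_const ell nrm x z g z0 r) in growthk.
rewrite -/(loss ell x (z + v)) in lossk.
have pow_le : nrm (z + v - z0) `^ r <= nrm (z - z0) `^ r + nrm v `^ r.
  apply: le_trans (powRD_subadditive _ _ _); rewrite ?is_norm_ge0//; last first.
    by rewrite r0 ltW.
  rewrite ge0_ler_powR// ?nnegrE ?addr_ge0 ?is_norm_ge0//.
  by case: nrmP => _ _; rewrite addrAC; apply.
have := ler_wpM2l (ltW g0) pow_le; lra.
Qed.

Lemma dual_norm_le_lipschitz_const (R : realType) (m n K : nat)
    (ell : 'I_K -> 'rV[R]_n -> 'rV[R]_m -> R) nrm x k z xi :
  is_norm nrm -> concave_function (ell k x) ->
  superdifferential (ell k x) z xi ->
  dual_norm nrm xi <= lipschitz_const ell nrm x z.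
Proof.
move=> nrmP ell_concave hxi.
apply: le_trans
  (fam_max_ge (fun j => sup (supergradient_norms ell nrm x j z)) k).
apply: ub_le_sup; last by exists xi.
exact/has_max_has_ubound/dual_norm_superdifferential_has_max.
Qed.

Lemma lipschitz_const_ge0 (R : realType) (m n K : nat)
    (ell : 'I_K -> 'rV[R]_n -> 'rV[R]_m -> R) nrm x k z :
  is_norm nrm -> concave_function (ell k x) ->
  0 <= lipschitz_const ell nrm x z.
Proof.
move=> nrmP ell_concave.
have [xi hxi] := superdifferential_nonempty z ell_concave.
apply: le_trans (dual_norm_ge0 nrmP xi) _.
exact: dual_norm_le_lipschitz_const hxi.
Qed.

Lemma lipschitz_const_bound (R : realType) (m n K : nat)
    (ell : 'I_K -> 'rV[R]_n -> 'rV[R]_m -> R) nrm x k z v :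
  is_norm nrm -> concave_function (ell k x) ->
  ell k x (z + v) - ell k x z <= lipschitz_const ell nrm x z * nrm v.
Proof.
move=> nrmP ell_concave.
have [xi hxi] := superdifferential_nonempty z ell_concave.
have xi_le := dual_norm_le_lipschitz_const nrmP ell_concave hxi.
apply: le_trans (ler_wpM2r (is_norm_ge0 nrmP v) xi_le).
apply: le_trans (dot_le_dual_normM nrmP xi v).
by have := hxi (z + v); rewrite addrAC subrr add0r lerBlDl.
Qed.

Section LocalPerturbations.
Context {R : realType} {m : nat}.
Variables (Z : set 'rV[R]_m) (c : 'rV[R]_m -> 'rV[R]_m -> R).
Variables (nrm : 'rV[R]_m -> R) (p : R).
Hypotheses (hc : transport_cost Z c) (Zclosed : closed Z).
Hypotheses (nrmP : is_norm nrm) (p1 : 1 <= p).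
Hypothesis c_coercive :
  forall z zh, Z z -> Z zh -> nrm (z - zh) `^ p <= c z zh.

Lemma perturbation_norm_le zi u v : Z zi -> Z (zi + v) -> c (zi + v) zi <= u ->
  nrm v <= u `^ p^-1.
Proof.
move=> Zzi Zv cu; apply: le_powR_inv; rewrite ?is_norm_ge0//.
  by apply: lt_le_trans p1.
apply: le_trans cu; have := c_coercive Zv Zzi.
by rewrite addrAC subrr add0r.
Qed.

Lemma shift_continuous (zi : 'rV[R]_m) : continuous (fun v => zi + v).
Proof.
by move=> v; apply: continuousD; [exact: cst_continuous|exact: cvg_id].
Qed.

Lemma perturbations_compact zi u : Z zi ->
  compact [set v | Z (zi + v) /\ c (zi + v) zi <= u].
Proof.
move=> Zzi; apply: (@is_norm_bounded_compact _ _ nrm _ _ (u `^ p^-1)) => //;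
  last by move=> v [Zv cu]; exact: perturbation_norm_le Zzi Zv cu.
move=> v clv.
have Zv : Z (zi + v).
  have clZ : closed [set v | Z (zi + v)].
    by apply: preimage_closed => // w _; exact: shift_continuous.
  by apply: clZ; apply: closureS clv => w [].
split=> //; rewrite leNgt; apply/negP => uc.
case: hc => _ lsc _ _.
have [V nV Vc] := lsc (zi + v, zi) u uc.
have {}nV : within (Z `*` Z) (nbhs (zi + v, zi)) V by rewrite nbhs_subspace_in.
have shift2 : {for v, continuous (fun w : 'rV[R]_m => (zi + w, zi))}.
  apply: (@cvg_pair _ _ _ (nbhs v) (nbhs (zi + v)) (nbhs zi)).
    exact: shift_continuous.
  exact: cst_continuous.
have [w [[Zw cw] VZw]] := clv _ (shift2 _ nV).
by have := Vc _ (VZw (conj Zw Zzi)); rewrite lte_fin ltNge cw.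
Qed.

Lemma local_losses_has_max (n K : nat)
    (ell : 'I_K -> 'rV[R]_n -> 'rV[R]_m -> R) x k zi u :
  concave_function (ell k x) -> Z zi -> 0 <= u ->
  has_max (local_losses Z c ell x k zi u).
Proof.
move=> ell_concave Zzi u0; apply: usc_compact_has_max.
- by case: hc => _ _ c0 _; exists 0; rewrite /= addr0 c0.
- exact: perturbations_compact.
- move=> v a _ lt_a.
  exact: (@shift_continuous zi v _ (concave_usc ell_concave lt_a)).
Qed.

End LocalPerturbations.

Theorem lemma8 (R : realType) (n m K N : nat)
    (X : set 'rV[R]_n) (Z : set 'rV[R]_m)
    (c : 'rV[R]_m -> 'rV[R]_m -> R)
    (zh : 'I_N -> 'rV[R]_m) (rho : R)
    (ell : 'I_K -> 'rV[R]_n -> 'rV[R]_m -> R)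
    (nrm : 'rV[R]_m -> R) (p : R)
    (hc : transport_cost Z c)
    (hzh : forall j, Z (zh j))
    (hrho : 0 < rho)
    (hreg : regularity X Z c ell nrm p zh rho)
    (x : 'rV[R]_n) (hx : X x)
    (horacle : local_oracle Z c ell x)
    (k : 'I_K) (i : 'I_N) :
  let S := local_worst_case Z c ell x k (zh i) in
  (* the maxima defining S_k and G_i exist *)
  (forall u, 0 <= u -> has_max (local_losses Z c ell x k (zh i) u)) /\
  (forall j, has_max (supergradient_norms ell nrm x j (zh i))) /\
  forall u, 0 <= u ->
    (p = 1 -> forall g z0 r, growth_bound Z ell nrm x g z0 r ->
      S u - S 0 <= growth_const ell nrm x (zh i) g z0 r + g * u `^ r) /\
    S u - S 0 <= lipschitz_const ell nrm x (zh i) * u `^ p^-1.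
Proof.
move=> S.
have [[_ _ _ _ [Zclosed _]] [_ _ ell_concave] [nrmP p1 c_coercive _]] := hreg.
have c0 : c (zh i) (zh i) = 0 by case: hc => _ _ + _; apply.
have S_max u (u0 : 0 <= u) : has_max (local_losses Z c ell x k (zh i) u).
  by apply: (local_losses_has_max hc Zclosed nrmP p1).
have S_diff u b : 0 <= u ->
    (forall v, Z (zh i + v) -> nrm v <= u `^ p^-1 ->
       ell k x (zh i + v) - ell k x (zh i) <= b) ->
    S u - S 0 <= b.
  move=> u0 bound.
  have S0 : ell k x (zh i) <= S 0.
    apply: ub_le_sup; first exact/has_max_has_ubound/S_max.
    by exists 0; rewrite /= addr0// c0.
  suff : S u <= b + ell k x (zh i) by lra.
  apply: ge_sup; first by have [y Ay _] := S_max u u0; exists y.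
  move=> _ [v [Zv cu] <-]; rewrite -lerBlDr; apply: bound => //.
  exact: (perturbation_norm_le nrmP p1 c_coercive _ Zv cu).
split=> //; split=> [j|u u0].
  exact: dual_norm_superdifferential_has_max.
split=> [pE g z0 r hg|]; apply: S_diff => // v Zv vu.
  apply: le_trans (growth_const_bound k nrmP hg Zv) _.
  case: hg => g0 _ /andP[r0 _] _.
  rewrite lerD2l; apply: ler_wpM2l; first exact: ltW.
  move: vu; rewrite pE invr1 powRr1// => vu.
  by rewrite ge0_ler_powR// nnegrE is_norm_ge0.
apply: le_trans (lipschitz_const_bound (zh i) v nrmP (ell_concave k x)) _.
by rewrite ler_wpM2l// (lipschitz_const_ge0 _ nrmP (ell_concave k x)).
Qed.
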